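(* Let $\mathcal{G}$ be a connected groupoid, $x\in\mathcal{G}_0$, $\tau(x)=\{\tau_y\}_{y\in\mathcal{G}_0}$ a transversal for $x$, and $A$ a ring. Let $\alpha=(A_g,\alpha_g)_{g\in\mathcal{G}}$ be a partial action of $\mathcal{G}$ on $A$ and let $\theta:=\mathtt{Ext}(\mathtt{Res}(\alpha))$. Then: (i) $\theta\le\alpha$, that is, $\alpha_g$ is an extension of $\theta_g$ for all $g\in\mathcal{G}$; (ii) $\theta=\alpha$ if and only if $A_g\subseteq A_{\tau_{t(g)}}\cap A_{g\tau_{s(g)}}$ for all $g\in\mathcal{G}\setminus\mathcal{G}_0$; (iii) $\mathtt{Res}(\mathtt{Ext}(\gamma))=\gamma$ for every object $\gamma$ of $\mathsf{D}_{\mathcal{G},\tau(x)}(A)$.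
   Context: Rings are associative and not necessarily unital; ideals are two-sided. A groupoid $\mathcal{G}$ is a small category in which every morphism is an isomorphism; $g\in\mathcal{G}$ means $g$ is a morphism; $\mathcal{G}_0$ is the set of objects, each object being identified with its identity morphism; $s(g),t(g)$ are source and target; composition is written right to left, so $gh$ is defined iff $s(g)=t(h)$. $\mathcal{G}(x,y)=\{g\in\mathcal{G}: s(g)=x,\ t(g)=y\}$ and $\mathcal{G}(x)=\mathcal{G}(x,x)$. $\mathcal{G}$ is connected if $\mathcal{G}(x,y)\neq\emptyset$ for all $x,y\in\mathcal{G}_0$. A partial action of $\mathcal{G}$ on a ring $A$ is a family $\alpha=(A_g,\alpha_g)_{g\in\mathcal{G}}$ such that: (P1) for each $g$, $A_{t(g)}$ is an ideal of $A$, $A_g$ is an ideal of $A_{t(g)}$ and $\alpha_g:A_{g^{-1}}\to A_g$ is a ring isomorphism; (P2) $\alpha_x=\mathrm{id}_{A_x}$ for $x\in\mathcal{G}_0$; (P3) $\alpha_h^{-1}(A_{g^{-1}}\cap A_h)\subseteq A_{(gh)^{-1}}$ whenever $s(g)=t(h)$; (P4) $\alpha_g(\alpha_h(a))=\alpha_{gh}(a)$ for all $a\in\alpha_h^{-1}(A_{g^{-1}}\cap A_h)$ whenever $s(g)=t(h)$. A partial action of a group $H$ on a ring $I$ is a partial action of $H$ viewed as a one-object groupoid, the ideal attached to the identity of $H$ being $I$ itself. A transversal for $x\in\mathcal{G}_0$ is a family $\tau(x)=\{\tau_y\}_{y\in\mathcal{G}_0}$ with $\tau_y\in\mathcal{G}(x,y)$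 and $\tau_x=x$. For $g\in\mathcal{G}$ put $g_x:=\tau_{t(g)}^{-1}g\tau_{s(g)}\in\mathcal{G}(x)$. Composition of partial bijections $f:X\to Y$, $f':X'\to Y'$ of a set is $f'f:f^{-1}(X'\cap Y)\to f'(X'\cap Y)$. An object of $\mathsf{D}_{\mathcal{G},\tau(x)}(A)$ is a triple $(I,\gamma_{\tau(x)},\gamma_{(x)})$ where: $I=\{I_y\}_{y\in\mathcal{G}_0}$ is a family of ideals of $A$; $\gamma_{\tau(x)}=\{\gamma_{\tau_y}:I_{\tau_y^{-1}}\to I_{\tau_y}\}_{y\in\mathcal{G}_0}$ is a family of ring isomorphisms with $I_{\tau_y^{-1}}$ an ideal of $I_x$, $I_{\tau_y}$ an ideal of $I_y$, and $\gamma_{\tau_x}=\gamma_x=\mathrm{id}_{I_x}$; $\gamma_{(x)}=(I_h,\gamma_h)_{h\in\mathcal{G}(x)}$ is a partial action of the group $\mathcal{G}(x)$ on $I_x$; and for all $g\in\mathcal{G}$ the set $\gamma_{\tau_{t(g)}}\big(I_{\tau_{t(g)}^{-1}}\cap\gamma_{g_x}(I_{\tau_{s(g)}^{-1}}\cap I_{g_x^{-1}})\big)$ is an ideal of $I_{t(g)}$. $\mathtt{Res}$: for a partial action $\alpha=(A_g,\alpha_g)_{g\in\mathcal{G}}$ of $\mathcal{G}$ on $A$, $\mathtt{Res}(\alpha)$ is the object $(\{A_y\}_{y\in\mathcal{G}_0},\ \{\alpha_{\tau_y}:A_{\tau_y^{-1}}\to A_{\tau_y}\}_{y\in\mathcal{G}_0},\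 (A_h,\alpha_h)_{h\in\mathcal{G}(x)})$ of $\mathsf{D}_{\mathcal{G},\tau(x)}(A)$. $\mathtt{Ext}$: for an object $\gamma=(I,\gamma_{\tau(x)},\gamma_{(x)})$ of $\mathsf{D}_{\mathcal{G},\tau(x)}(A)$, $\mathtt{Ext}(\gamma)$ is the partial action $\theta=(B_g,\theta_g)_{g\in\mathcal{G}}$ of $\mathcal{G}$ on $A$ with $\theta_y=\mathrm{id}_{I_y}$ for $y\in\mathcal{G}_0$, $\theta_g=\gamma_{\tau_{t(g)}}\gamma_{g_x}\gamma_{\tau_{s(g)}}^{-1}$ (composition of partial bijections) for $g\notin\mathcal{G}_0$, and $B_g$ the range of $\theta_g$. *)

(* Defs.v *)
From HB Require Import structures.
From mathcomp Require Import all_boot all_algebra.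
From mathcomp Require Import boolp classical_sets.

Set Implicit Arguments.
Unset Strict Implicit.
Unset Printing Implicit Defensive.

Import GRing.Theory.

Local Open Scope classical_set_scope.
Local Open Scope ring_scope.

(* Associative rings, not necessarily unital. *)

HB.mixin Record Zmodule_isRng R & GRing.Zmodule R := {
  rmul : R -> R -> R;
  rmulA : associative rmul;
  rmulDl : left_distributive rmul +%R;
  rmulDr : right_distributive rmul +%R
}.

#[short(type="rngType")]
HB.structure Definition Rng := {R of Zmodule_isRng R & GRing.Zmodule R}.

(* [ideal_in R I]: I is a two-sided ideal of the (sub)ring R of A; ideals of A
   itself are those of [setT]. *)
Record ideal_in (A : rngType) (R I : set A) : Prop := IdealOf {
  ideal_sub : I `<=` R;
  ideal0 : I 0;
  idealB : forall a b, I a -> I b -> I (a - b);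
  idealMl : forall r a, R r -> I a -> I (rmul r a);
  idealMr : forall r a, R r -> I a -> I (rmul a r)
}.

(* A partial bijection is given by its graph, so Leibniz equality of [pbij] is
   equality of domain, range and values, and [pextends] is graph inclusion. *)
Record pbij (T : Type) := PBij {
  pgraph :> T -> T -> Prop;
  pbij_fun : forall a b b', pgraph a b -> pgraph a b' -> b = b';
  pbij_inj : forall a a' b, pgraph a b -> pgraph a' b -> a = a'
}.

Section PartialBijections.
Variable T : Type.
Implicit Types (f g : pbij T) (X : set T).

Definition pdom f : set T := [set a | exists b, f a b].
Definition pran f : set T := [set b | exists a, f a b].
Definition pimage f X : set T := [set b | exists2 a, X a & f a b].

Lemma pbij_eq f g : (forall a b, f a b <-> g a b) -> f = g.
Proof.
case: f g => [f f1 f2] [g g1 g2] /= fg.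
have e : f = g by apply/funext => a; apply/funext => b; apply/propext.
by move: f1 f2; rewrite e => f1 f2; congr PBij; apply: Prop_irrelevance.
Qed.

Fact pid_fun X a b b' : X a /\ a = b -> X a /\ a = b' -> b = b'.
Proof. by move=> [_ <-] [_ <-]. Qed.

Fact pid_inj X a a' b : X a /\ a = b -> X a' /\ a' = b -> a = a'.
Proof. by move=> [_ ->] [_ ->]. Qed.

Definition pid X : pbij T := PBij (@pid_fun X) (@pid_inj X).

Definition pinv f : pbij T :=
  @PBij T (fun b a => f a b)
    (fun b a a' => @pbij_inj T f a a' b) (fun b b' a => @pbij_fun T f a b b').

Definition pcomp_graph g f a c : Prop := exists2 b, f a b & g b c.

Fact pcomp_fun g f a c c' :
  pcomp_graph g f a c -> pcomp_graph g f a c' -> c = c'.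
Proof.
by move=> [b ab bc] [b' ab' bc']; rewrite -(pbij_fun ab ab') in bc';
  apply: pbij_fun bc bc'.
Qed.

Fact pcomp_inj g f a a' c :
  pcomp_graph g f a c -> pcomp_graph g f a' c -> a = a'.
Proof.
by move=> [b ab bc] [b' ab' bc']; rewrite -(pbij_inj bc bc') in ab';
  apply: pbij_inj ab ab'.
Qed.

Definition pcomp g f : pbij T := PBij (@pcomp_fun g f) (@pcomp_inj g f).

Definition pextends g f : Prop := forall a b, f a b -> g a b.

Lemma pdom_pcomp g f :
  pdom (pcomp g f) = pimage (pinv f) (pdom g `&` pran f).
Proof.
apply/seteqP; split=> a.
  by case=> c [b ab bc]; exists b => //; split; [exists c | exists a].
by case=> b [[c bc] _] ab; exists c, b.
Qed.

Lemma pran_pcomp g f : pran (pcomp g f) = pimage g (pdom g `&` pran f).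
Proof.
apply/seteqP; split=> c.
  by case=> a [b ab bc]; exists b => //; split; [exists c | exists a].
by case=> b [_ [a ab]] bc; exists a, b.
Qed.

Lemma pdom_pinv f : pdom (pinv f) = pran f. Proof. by []. Qed.
Lemma pran_pinv f : pran (pinv f) = pdom f. Proof. by []. Qed.

Lemma pdom_pid X : pdom (pid X) = X.
Proof. by apply/seteqP; split=> a; [case=> b [] | exists a]. Qed.

Lemma pran_pid X : pran (pid X) = X.
Proof. by apply/seteqP; split=> a; [case=> b [] + <- | exists a]. Qed.

End PartialBijections.

(* [ring_iso I J f]: the partial bijection f is a ring isomorphism I -> J. *)
Record ring_iso (A : rngType) (I J : set A) (f : pbij A) : Prop := RingIso {
  riso_dom : pdom f = I;
  riso_ran : pran f = J;
  risoD : forall a b a' b', f a b -> f a' b' -> f (a + a') (b + b');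
  risoM : forall a b a' b', f a b -> f a' b' -> f (rmul a a') (rmul b b')
}.

(* [mor y z] is the set of morphisms with source y and target z, and
   [gcomp g h] is the composite gh, written right to left. *)
Record groupoid := Groupoid {
  obj :> Type;
  mor : obj -> obj -> Type;
  gid : forall y, mor y y;
  gcomp : forall w y z, mor y z -> mor w y -> mor w z;
  ginv : forall y z, mor y z -> mor z y;
  gcompA : forall v w y z (g : mor y z) (h : mor w y) (k : mor v w),
    gcomp g (gcomp h k) = gcomp (gcomp g h) k;
  gcomp1g : forall y z (g : mor y z), gcomp (gid z) g = g;
  gcompg1 : forall y z (g : mor y z), gcomp g (gid y) = g;
  gcompVg : forall y z (g : mor y z), gcomp (ginv g) g = gid y;
  gcompgV : forall y z (g : mor y z), gcomp g (ginv g) = gid z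
}.

Arguments mor {g} y z : rename.
Arguments gid {g} y : rename.
Arguments gcomp {g w y z} _ _ : rename.
Arguments ginv {g y z} _ : rename.

(* The morphisms belonging to G_0. *)
Inductive is_id (G : groupoid) : forall y z : G, mor y z -> Prop :=
  IsId (y : G) : is_id (gid y).

Definition gconnected (G : groupoid) : Prop :=
  forall y z : G, inhabited (mor y z).

Definition vertex_group (G : groupoid) (x : G) : groupoid :=
  @Groupoid unit (fun _ _ => mor x x) (fun _ => gid x)
    (fun _ _ _ => @gcomp G x x x) (fun _ _ => @ginv G x x)
    (fun _ _ _ _ => @gcompA G x x x x) (fun _ _ => @gcomp1g G x x)
    (fun _ _ => @gcompg1 G x x) (fun _ _ => @gcompVg G x x)
    (fun _ _ => @gcompgV G x x).

Record gtransversal (G : groupoid) (x : G) := Transversal {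
  transv :> forall y : G, mor x y;
  transv_base : transv x = gid x
}.

(* g_x = tau_{t(g)}^{-1} g tau_{s(g)}. *)
Definition gloop (G : groupoid) (x : G) (tau : gtransversal x) (y z : G)
    (g : mor y z) : mor x x :=
  gcomp (ginv (tau z)) (gcomp g (tau y)).

Section GroupoidTheory.
Variable G : groupoid.

Lemma ginv_uniq (y z : G) (g : mor y z) (h : mor z y) :
  gcomp h g = gid y -> h = ginv g.
Proof. by move=> e; rewrite -[h]gcompg1 -(gcompgV g) gcompA e gcomp1g. Qed.

Lemma ginvK (y z : G) (g : mor y z) : ginv (ginv g) = g.
Proof. by apply/esym/ginv_uniq; rewrite gcompgV. Qed.

Lemma ginv1 (y : G) : ginv (gid y) = gid y.
Proof. by apply/esym/ginv_uniq; rewrite gcomp1g. Qed.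

Lemma gcompKV (w y z : G) (g : mor y z) (h : mor w z) :
  gcomp g (gcomp (ginv g) h) = h.
Proof. by rewrite gcompA gcompgV gcomp1g. Qed.

Lemma gcompK (w y z : G) (g : mor y z) (h : mor w y) :
  gcomp (ginv g) (gcomp g h) = h.
Proof. by rewrite gcompA gcompVg gcomp1g. Qed.

Lemma ginvM (w y z : G) (g : mor y z) (h : mor w y) :
  ginv (gcomp g h) = gcomp (ginv h) (ginv g).
Proof. by apply/esym/ginv_uniq; rewrite -gcompA gcompK gcompVg. Qed.

Lemma is_id_ginv (y z : G) (g : mor y z) : is_id g -> is_id (ginv g).
Proof. by case=> u; rewrite ginv1. Qed.

Variables (x : G) (tau : gtransversal x).

Lemma loop1 (y : G) : gloop tau (gid y) = gid x.
Proof. by rewrite /gloop gcomp1g gcompVg. Qed.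

Lemma loopV (y z : G) (g : mor y z) : gloop tau (ginv g) = ginv (gloop tau g).
Proof. by rewrite /gloop !ginvM ginvK gcompA. Qed.

Lemma loopM (w y z : G) (g : mor y z) (h : mor w y) :
  gloop tau (gcomp g h) = gcomp (gloop tau g) (gloop tau h).
Proof. by rewrite /gloop -!gcompA gcompKV. Qed.

End GroupoidTheory.

Record pfamily (G : groupoid) (A : rngType) := PFamily {
  act_set : forall y z : G, mor y z -> set A;
  act_map : forall y z : G, mor y z -> pbij A
}.

Arguments act_set {G A} p {y z} _.
Arguments act_map {G A} p {y z} _.

Lemma pfamily_eq (G : groupoid) (A : rngType) (p q : pfamily G A) :
  (forall y z (g : @mor G y z), act_set p g = act_set q g) ->
  (forall y z (g : @mor G y z), act_map p g = act_map q g) -> p = q.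
Proof.
case: p q => [ps pm] [qs qm] /= es em.
by congr PFamily; do 3![apply: functional_extensionality_dep => ?].
Qed.

(* [is_paction R alpha]: alpha is a partial action of G on the (sub)ring R
   of A. In [pact_comp], [pcomp (alpha_g) (alpha_h) a b] says that
   alpha_g(alpha_h(a)) is defined and equal to b. *)
Record is_paction (G : groupoid) (A : rngType) (R : set A)
    (alpha : pfamily G A) : Prop := IsPAction {
  pact_obj : forall z : G, ideal_in R (act_set alpha (gid z));
  pact_ideal : forall (y z : G) (g : mor y z),
    ideal_in (act_set alpha (gid z)) (act_set alpha g);
  pact_iso : forall (y z : G) (g : mor y z),
    ring_iso (act_set alpha (ginv g)) (act_set alpha g) (act_map alpha g);
  pact_id : forall y : G, act_map alpha (gid y) = pid (act_set alpha (gid y));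
  pact_sub : forall (w y z : G) (g : mor y z) (h : mor w y),
    pimage (pinv (act_map alpha h)) (act_set alpha (ginv g) `&` act_set alpha h)
      `<=` act_set alpha (ginv (gcomp g h));
  pact_comp : forall (w y z : G) (g : mor y z) (h : mor w y) (a : A),
    pimage (pinv (act_map alpha h))
      (act_set alpha (ginv g) `&` act_set alpha h) a ->
    forall b, pcomp (act_map alpha g) (act_map alpha h) a b ->
      act_map alpha (gcomp g h) a b
}.

Record paction (G : groupoid) (A : rngType) := PAction {
  paction_family :> pfamily G A;
  pactionP : is_paction setT paction_family
}.

Lemma paction_eq (G : groupoid) (A : rngType) (p q : paction G A) :
  paction_family p = paction_family q -> p = q.
Proof.
case: p q => [p pP] [q qP] /= e; move: pP; rewrite e => pP.
by congr PAction; apply: Prop_irrelevance.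
Qed.

Definition paction_le (G : groupoid) (A : rngType) (theta alpha : paction G A)
    : Prop :=
  forall (y z : G) (g : mor y z), pextends (act_map alpha g) (act_map theta g).

(* The data (I, gamma_{tau(x)}, gamma_{(x)}): [dI y], [dsrc y] and [dtgt y] are
   I_y, I_{tau_y^{-1}} and I_{tau_y}; [dgrp] is gamma_{(x)}. *)
Record dtriple (G : groupoid) (x : G) (A : rngType) := DTriple {
  dI : G -> set A;
  dsrc : G -> set A;
  dtgt : G -> set A;
  dtau : G -> pbij A;
  dgrp : pfamily (vertex_group x) A
}.

Definition dgrp_set (G : groupoid) (x : G) (A : rngType) (d : dtriple x A)
    (h : mor x x) : set A := @act_set (vertex_group x) A (dgrp d) tt tt h.
Definition dgrp_map (G : groupoid) (x : G) (A : rngType) (d : dtriple x A)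
    (h : mor x x) : pbij A := @act_map (vertex_group x) A (dgrp d) tt tt h.

Record is_dobject (G : groupoid) (x : G) (tau : gtransversal x) (A : rngType)
    (d : dtriple x A) : Prop := IsDObject {
  dobj_ideal : forall y, ideal_in setT (dI d y);
  dobj_src : forall y, ideal_in (dI d x) (dsrc d y);
  dobj_tgt : forall y, ideal_in (dI d y) (dtgt d y);
  dobj_iso : forall y, ring_iso (dsrc d y) (dtgt d y) (dtau d y);
  dobj_base : dtau d x = pid (dI d x);
  dobj_grp : is_paction (dI d x) (dgrp d);
  dobj_grp1 : dgrp_set d (gid x) = dI d x;
  dobj_range : forall (y z : G) (g : mor y z),
    ideal_in (dI d z)
      (pimage (dtau d z)
        (dsrc d z `&` pimage (dgrp_map d (gloop tau g))
                        (dsrc d y `&` dgrp_set d (ginv (gloop tau g)))))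
}.

(* The objects of D_{G,tau(x)}(A). *)
Record dobject (G : groupoid) (x : G) (tau : gtransversal x) (A : rngType) :=
  DObject {
    dobject_triple :> dtriple x A;
    dobjectP : is_dobject tau dobject_triple
  }.

Lemma dobject_eq (G : groupoid) (x : G) (tau : gtransversal x) (A : rngType)
    (c d : dobject tau A) : dobject_triple c = dobject_triple d -> c = d.
Proof.
case: c d => [c cP] [d dP] /= e; move: cP; rewrite e => cP.
by congr DObject; apply: Prop_irrelevance.
Qed.

Lemma idealI (A : rngType) (R I J : set A) :
  ideal_in R I -> ideal_in R J -> ideal_in R (I `&` J).
Proof.
move=> HI HJ; split.
- by move=> a [/(ideal_sub HI)].
- by split; [apply: ideal0 HI | apply: ideal0 HJ].
- by move=> a b [? ?] [? ?]; split; [apply: (idealB HI) | apply: (idealB HJ)].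
- by move=> r a ? [? ?]; split; [apply: (idealMl HI) | apply: (idealMl HJ)].
- by move=> r a ? [? ?]; split; [apply: (idealMr HI) | apply: (idealMr HJ)].
Qed.

Lemma ideal_self (A : rngType) (R I : set A) : ideal_in R I -> ideal_in I I.
Proof.
move=> HI; split.
- by [].
- exact: ideal0 HI.
- exact: idealB HI.
- by move=> r a /(ideal_sub HI); apply: (idealMl HI).
- by move=> r a /(ideal_sub HI); apply: (idealMr HI).
Qed.

Section PActionTheory.
Variables (G : groupoid) (A : rngType) (R : set A) (alpha : pfamily G A).
Hypothesis H : is_paction R alpha.

Lemma pact_dom (y z : G) (g : mor y z) :
  pdom (act_map alpha g) = act_set alpha (ginv g).
Proof. exact: riso_dom (pact_iso H g). Qed.

Lemma pact_ran (y z : G) (g : mor y z) :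
  pran (act_map alpha g) = act_set alpha g.
Proof. exact: riso_ran (pact_iso H g). Qed.

Lemma pact_compR (w y z : G) (g : mor y z) (h : mor w y) a b c :
  act_map alpha h a b -> act_map alpha g b c -> act_map alpha (gcomp g h) a c.
Proof.
move=> ab bc; apply: (pact_comp H); last by exists b.
exists b => //; split; first by rewrite -pact_dom; exists c.
by rewrite -pact_ran; exists a.
Qed.

Lemma pact_inv_sub (y z : G) (g : mor y z) a b :
  act_map alpha g a b -> act_map alpha (ginv g) b a.
Proof.
move=> ab; have : pdom (act_map alpha (ginv g)) b.
  by rewrite pact_dom ginvK -pact_ran; exists a.
case=> c bc; have := pact_compR ab bc.
by rewrite gcompVg (pact_id H) => -[_ ->].
Qed.

Lemma pact_inv (y z : G) (g : mor y z) :
  act_map alpha (ginv g) = pinv (act_map alpha g).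
Proof.
apply: pbij_eq => a b; split; last exact: pact_inv_sub.
by move/pact_inv_sub; rewrite ginvK.
Qed.

Lemma pact_image_sub (w y z : G) (h : mor y z) (k : mor w y) :
  pimage (act_map alpha h) (act_set alpha (ginv h) `&` act_set alpha k)
    `<=` act_set alpha (gcomp h k).
Proof.
move=> b [a [ah ak] ab].
rewrite -[gcomp h k]ginvK ginvM; apply: (pact_sub H); rewrite ginvK.
exists a; first by split.
by rewrite pact_inv.
Qed.

Lemma pact_image (w y z : G) (h : mor y z) (k : mor w y) :
  pimage (act_map alpha h) (act_set alpha (ginv h) `&` act_set alpha k)
  = act_set alpha h `&` act_set alpha (gcomp h k).
Proof.
apply/seteqP; split=> b.
  move=> hb; split; last exact: pact_image_sub.
  by case: hb => a _ ab; rewrite -pact_ran; exists a.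
case=> bh bhk; have [a ab] : pran (act_map alpha h) b by rewrite pact_ran.
exists a => //; split; first by rewrite -pact_dom; exists b.
rewrite -[k](gcompK h); apply: pact_image_sub; rewrite ginvK.
by exists b; [split | rewrite pact_inv].
Qed.

End PActionTheory.

Section ResExt.
Variables (G : groupoid) (x : G) (tau : gtransversal x) (A : rngType).

Definition Res_triple (alpha : pfamily G A) : dtriple x A :=
  @DTriple G x A (fun y => act_set alpha (gid y))
    (fun y => act_set alpha (ginv (tau y))) (fun y => act_set alpha (tau y))
    (fun y => act_map alpha (tau y))
    (@PFamily (vertex_group x) A
       (fun _ _ (h : @mor G x x) => act_set alpha h)
       (fun _ _ (h : @mor G x x) => act_map alpha h)).

Lemma Res_range (alpha : paction G A) (y z : G) (g : mor y z) :
  pimage (act_map alpha (tau z))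
    (act_set alpha (ginv (tau z)) `&`
     pimage (act_map alpha (gloop tau g))
       (act_set alpha (ginv (tau y)) `&` act_set alpha (ginv (gloop tau g))))
  = act_set alpha (tau z) `&` act_set alpha (gcomp g (tau y))
    `&` act_set alpha g.
Proof.
have H := pactionP alpha.
rewrite [X in pimage (act_map alpha (gloop tau g)) X]setIC (pact_image H).
have -> : gcomp (gloop tau g) (ginv (tau y)) = gcomp (ginv (tau z)) g.
  by rewrite /gloop -!gcompA gcompgV gcompg1.
have imI (S T : set A) : pimage (act_map alpha (tau z)) (S `&` T)
    = pimage (act_map alpha (tau z)) S `&` pimage (act_map alpha (tau z)) T.
  apply/seteqP; split=> b; first by case=> a [Sa Ta] ab; split; exists a.
  by case=> -[a Sa ab] [a' Ta' /(pbij_inj ab) e]; subst a'; exists a.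
rewrite -[act_set alpha (ginv (tau z))]setIid setIACA imI !(pact_image H).
rewrite /gloop !gcompKV; apply/seteqP; split=> a.
  by case=> -[? ?] [_ ?]; split.
by case=> -[? ?] ?; split.
Qed.

Lemma Res_dobject (alpha : paction G A) : is_dobject tau (Res_triple alpha).
Proof.
have H := pactionP alpha; split=> //=.
- exact: pact_obj H.
- by move=> y; apply: (pact_ideal H).
- by move=> y; apply: (pact_ideal H).
- by move=> y; apply: (pact_iso H).
- by rewrite transv_base; apply: (pact_id H).
- split=> /=.
  + by move=> _; apply: ideal_self (pact_obj H x).
  + by move=> _ _; apply: (pact_ideal H).
  + by move=> _ _; apply: (pact_iso H).
  + by move=> _; apply: (pact_id H).
  + by move=> _ _ _; apply: (pact_sub H).
  + by move=> _ _ _; apply: (pact_comp H).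
- move=> y z g; rewrite /dgrp_map /dgrp_set /= Res_range.
  by do !apply: idealI; apply: (pact_ideal H).
Qed.

Definition Res (alpha : paction G A) : dobject tau A :=
  DObject (Res_dobject alpha).

Definition Ext_comp (d : dtriple x A) (y z : G) (g : mor y z) : pbij A :=
  pcomp (dtau d z) (pcomp (dgrp_map d (gloop tau g)) (pinv (dtau d y))).

Definition Ext_map (d : dtriple x A) (y z : G) (g : mor y z) : pbij A :=
  if pselect (is_id g) then pid (dI d z) else Ext_comp d g.

Definition Ext_family (d : dtriple x A) : pfamily G A :=
  PFamily (fun y z (g : mor y z) => pran (Ext_map d g))
          (fun y z (g : mor y z) => Ext_map d g).

Lemma Ext_map_id (d : dtriple x A) (y : G) : Ext_map d (gid y) = pid (dI d y).
Proof. by rewrite /Ext_map; case: pselect => // -[]; constructor. Qed.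

Lemma Ext_map_nid (d : dtriple x A) (y z : G) (g : mor y z) :
  ~ is_id g -> Ext_map d g = Ext_comp d g.
Proof. by rewrite /Ext_map; case: pselect. Qed.

Section ExtPAction.
Variable d : dobject tau A.
Let H := dobjectP d.
Let HG := dobj_grp H.

Lemma dgrp_inv (h : mor x x) : dgrp_map d (ginv h) = pinv (dgrp_map d h).
Proof. exact: (@pact_inv (vertex_group x) A _ _ HG tt tt h). Qed.

Lemma Ext_compV (y z : G) (g : mor y z) :
  Ext_comp d (ginv g) = pinv (Ext_comp d g).
Proof.
rewrite /Ext_comp loopV dgrp_inv; apply: pbij_eq => a b; split.
  by move=> [b' [a' ? ?] ?]; exists a' => //; exists b'.
by move=> [b' [a' ? ?] ?]; exists a' => //; exists b'.
Qed.

Lemma Ext_mapV (y z : G) (g : mor y z) :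
  Ext_map d (ginv g) = pinv (Ext_map d g).
Proof.
have [gi|gi] := pselect (is_id g).
  case: gi => u; rewrite ginv1 Ext_map_id; apply: pbij_eq => a b.
  by split=> -[? ?]; subst.
rewrite !Ext_map_nid ?Ext_compV // => /is_id_ginv.
by rewrite ginvK.
Qed.

Lemma Ext_comp_ran (y z : G) (g : mor y z) :
  pran (Ext_comp d g) =
  pimage (dtau d z)
    (dsrc d z `&` pimage (dgrp_map d (gloop tau g))
                    (dsrc d y `&` dgrp_set d (ginv (gloop tau g)))).
Proof.
have domE u : dsrc d u = pdom (dtau d u) by rewrite (riso_dom (dobj_iso H u)).
have gE h : dgrp_set d (ginv h) = pdom (dgrp_map d h).
  by rewrite /dgrp_map (@pact_dom (vertex_group x) A _ _ HG tt tt h).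
rewrite !domE gE; apply/seteqP; split=> b.
  case=> a [b' [a' aa' ab'] bb']; exists b' => //; split; first by exists b.
  by exists a' => //; split; [exists a | exists b'].
by case=> b' [_ [a' [[a aa'] _] ab']] bb'; exists a, b' => //; exists a'.
Qed.

Lemma Ext_ideal (y z : G) (g : mor y z) :
  ideal_in (dI d z) (pran (Ext_map d g)).
Proof.
have [gi|gi] := pselect (is_id g).
  case: gi => u; rewrite Ext_map_id pran_pid.
  exact: ideal_self (dobj_ideal H u).
by rewrite Ext_map_nid // Ext_comp_ran; apply: (dobj_range H).
Qed.

Lemma Ext_iso (y z : G) (g : mor y z) :
  ring_iso (pran (Ext_map d (ginv g))) (pran (Ext_map d g)) (Ext_map d g).
Proof.
split=> //; first by rewrite Ext_mapV.
- have [gi|gi] := pselect (is_id g).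
    case: gi => u a b a' b'; rewrite Ext_map_id => -[? <-] [? <-]; split=> //.
    have I := dobj_ideal H u.
    rewrite -[a']opprK; apply: (idealB I) => //; rewrite -[- a']sub0r.
    by apply: (idealB I) => //; apply: (ideal0 I).
  rewrite Ext_map_nid // => a b a' b' [c [e ? ?] ?] [c' [e' ? ?] ?].
  exists (c + c'); last by apply: (risoD (dobj_iso H z)).
  exists (e + e'); first by apply: (risoD (dobj_iso H y)).
  exact: (risoD (@pact_iso (vertex_group x) A _ _ HG tt tt (gloop tau g))).
- have [gi|gi] := pselect (is_id g).
    case: gi => u a b a' b'; rewrite Ext_map_id => -[? <-] [? <-]; split=> //.
    by apply: (idealMl (dobj_ideal H u)).
  rewrite Ext_map_nid // => a b a' b' [c [e ? ?] ?] [c' [e' ? ?] ?].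
  exists (rmul c c'); last by apply: (risoM (dobj_iso H z)).
  exists (rmul e e'); first by apply: (risoM (dobj_iso H y)).
  exact: (risoM (@pact_iso (vertex_group x) A _ _ HG tt tt (gloop tau g))).
Qed.

Lemma Ext_comp_sub (y z : G) (g : mor y z) :
  pextends (Ext_map d g) (Ext_comp d g).
Proof.
have [gi|gi] := pselect (is_id g); last by rewrite Ext_map_nid.
case: gi => u a b [b' [a' aa' ab'] bb']; rewrite Ext_map_id; split.
  apply: (ideal_sub (dobj_tgt H u)); rewrite -(riso_ran (dobj_iso H u)).
  by exists a'.
move: ab'; rewrite loop1 /dgrp_map (@pact_id (vertex_group x) A _ _ HG tt).
by case=> _ e; subst b'; apply: (@pbij_fun _ (dtau d u) a').
Qed.

Lemma Ext_mapM (w y z : G) (g : mor y z) (h : mor w y) a b c :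
  Ext_map d h a b -> Ext_map d g b c -> Ext_map d (gcomp g h) a c.
Proof.
have [gi|gi] := pselect (is_id g).
  case: gi h => u h; rewrite Ext_map_id gcomp1g.
  by move=> ab [_ e]; subst c.
have [hi|hi] := pselect (is_id h).
  case: hi g gi => u g _; rewrite Ext_map_id gcompg1.
  by case=> _ ->.
rewrite [Ext_map d g]Ext_map_nid // [Ext_map d h]Ext_map_nid //.
move=> [b1 [a1 aa1 ab1] bb1] [c1 [b2 bb2 bc1] cc1]; apply: Ext_comp_sub.
have e := pbij_inj bb1 bb2; subst b2.
exists c1 => //; exists a1 => //; rewrite loopM.
exact: (@pact_compR (vertex_group x) A _ _ HG tt tt tt _ _ _ _ _ ab1 bc1).
Qed.

Lemma Ext_is_paction : is_paction setT (Ext_family d).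
Proof.
split=> /=.
- by move=> z; rewrite Ext_map_id pran_pid; apply: (dobj_ideal H).
- by move=> y z g; rewrite Ext_map_id pran_pid; apply: Ext_ideal.
- exact: Ext_iso.
- by move=> y; rewrite Ext_map_id pran_pid.
- move=> w y z g h a [b [bg _] ab]; rewrite Ext_mapV.
  by move: bg; rewrite Ext_mapV => -[c bc]; exists c; apply: Ext_mapM bc.
- by move=> w y z g h a _ c [b ab bc]; apply: Ext_mapM bc.
Qed.

End ExtPAction.

Definition Ext (d : dobject tau A) : paction G A := PAction (Ext_is_paction d).

End ResExt.

(* Main.v *)
Require Import Defs.
From mathcomp Require Import all_boot all_algebra.
From mathcomp Require Import boolp classical_sets.

Set Implicit Arguments.
Unset Strict Implicit.
Unset Printing Implicit Defensive.

Local Open Scope classical_set_scope.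

(** By (P4), theta_g = alpha_{tau_z} alpha_{g_x} alpha_{tau_y}^{-1} is a
    restriction of alpha_g, and its range is the intersection of A_g with
    A_{tau_z} and A_{g tau_y}; since alpha_g is injective, theta_g = alpha_g as
    soon as the ranges agree. For (iii), the loops of tau_y and of h in G(x) are
    the identity of x and h itself, while gamma_{tau_x} is an identity map. *)

Lemma pextends_ran (T : Type) (f g : pbij T) :
  pextends g f -> pran g `<=` pran f -> f = g.
Proof.
move=> fg ran; apply: pbij_eq => a b; split; first exact: fg.
move=> gab; have [|a' fa'b] := ran b; first by exists a.
by rewrite (pbij_inj gab (fg _ _ fa'b)).
Qed.

Lemma is_id_obj (G : groupoid) (y z : G) (g : mor y z) : is_id g -> y = z.
Proof. by case. Qed.

(** Case analysis on [is_id] needs independent endpoints, so the claim is first proved for a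
    morphism [u] to [v] transported along [v = u]. Proof irrelevance then makes the transport
    trivial. *)
Lemma is_id_loop (G : groupoid) (y : G) (g : mor y y) : is_id g -> g = gid y.
Proof.
have cast (u v : G) (k : mor u v) (e : v = u) :
    is_id k -> eq_rect v (mor u) k u e = gid u.
  by move=> kid; case: kid e => w e; rewrite (Prop_irrelevance e erefl).
exact: (cast _ _ g erefl).
Qed.

Lemma dtriple_eq (G : groupoid) (x : G) (A : rngType) (c d : dtriple x A) :
  dI c = dI d -> dsrc c = dsrc d -> dtgt c = dtgt d -> dtau c = dtau d ->
  dgrp c = dgrp d -> c = d.
Proof. by case: c d => ? ? ? ? ? [? ? ? ? ?] /= -> -> -> -> ->. Qed.

Section ExtRes.
Variables (G : groupoid) (x : G) (tau : gtransversal x) (A : rngType).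
Variable alpha : paction G A.
Let H := pactionP alpha.

Lemma gloopK (y z : G) (g : mor y z) :
  gcomp (tau z) (gcomp (gloop tau g) (ginv (tau y))) = g.
Proof. by rewrite /gloop -!gcompA gcompKV gcompgV gcompg1. Qed.

Lemma Ext_Res_le : paction_le (Ext (Res tau alpha)) alpha.
Proof.
move=> y z g a b /=; have [gi|gi] := pselect (is_id g).
  by case: gi => u; rewrite Ext_map_id (pact_id H).
rewrite Ext_map_nid // => -[c [e ae ec] cb].
(* Once g is factored as tau_z g_x tau_y^{-1}, two uses of (P4) glue the three values. *)
rewrite -[g]gloopK; apply: (pact_compR H) cb; apply: (pact_compR H) ec.
exact: (pact_inv_sub H) ae.
Qed.

Lemma Ext_Res_set (y z : G) (g : mor y z) : ~ is_id g ->
  act_set (Ext (Res tau alpha)) g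
  = act_set alpha (tau z) `&` act_set alpha (gcomp g (tau y))
    `&` act_set alpha g.
Proof.
move=> gi /=; rewrite Ext_map_nid // -Res_range.
exact: (Ext_comp_ran (Res tau alpha)).
Qed.

Lemma Ext_Res_eq :
  Ext (Res tau alpha) = alpha <->
  (forall (y z : G) (g : mor y z), ~ is_id g ->
     act_set alpha g `<=`
       act_set alpha (tau z) `&` act_set alpha (gcomp g (tau y))).
Proof.
split=> [e y z g gi | sub].
  (* Only the A_g on the left becomes B_g, which is an intersection containing the two required
     factors. *)
  by rewrite -{1}e Ext_Res_set // => a [].
have mapE (y z : G) (g : mor y z) :
    act_map (Ext (Res tau alpha)) g = act_map alpha g.
  have [gi|gi] := pselect (is_id g).
    by case: gi => u /=; rewrite Ext_map_id (pact_id H).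
  apply: pextends_ran; first exact: Ext_Res_le.
  rewrite (pact_ran H) (pact_ran (pactionP (Ext (Res tau alpha)))).
  by rewrite Ext_Res_set // => a ag; split=> //; apply: sub.
apply: paction_eq; apply: pfamily_eq => // y z g.
(* Each ideal is the range of its map, so equal maps force equal ideals. *)
by rewrite -(pact_ran H) -(pact_ran (pactionP (Ext (Res tau alpha)))) mapE.
Qed.

End ExtRes.

Section ResExtK.
Variables (G : groupoid) (x : G) (tau : gtransversal x) (A : rngType).
Variable d : dobject tau A.
Let H := dobjectP d.
Let HG := dobj_grp H.

Lemma dgrp_map1 : dgrp_map d (gid x) = pid (dI d x).
Proof.
rewrite /dgrp_map (@pact_id (vertex_group x) A _ _ HG tt).
by congr pid; apply: (dobj_grp1 H).
Qed.

Lemma gloop_base (h : mor x x) : gloop tau h = h.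
Proof. by rewrite /gloop transv_base ginv1 gcomp1g gcompg1. Qed.

Lemma gloop_tau (y : G) : gloop tau (tau y) = gid x.
Proof. by rewrite /gloop transv_base gcompg1 gcompVg. Qed.

(** For y = x the identity clause of [Ext_map] applies. Otherwise tau_y has distinct endpoints, and
    the two inner factors of the composite are the identity of I_x, which contains the domain of
    gamma_{tau_y}. *)
Lemma Ext_map_tau (y : G) : Ext_map tau d (tau y) = dtau d y.
Proof.
have [->|yx] := pselect (y = x).
  by rewrite transv_base Ext_map_id (dobj_base H).
rewrite Ext_map_nid => [|/is_id_obj/esym //].
rewrite /Ext_comp gloop_tau dgrp_map1 (dobj_base H).
apply: pbij_eq => a b; split; first by case=> c [e [_ ->] [_ ->]].
move=> ab; have xa : dI d x a.
  by apply: (ideal_sub (dobj_src H y)); rewrite -(riso_dom (dobj_iso H y)); exists b.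
by exists a => //; exists a.
Qed.

Lemma Ext_map_loop (h : mor x x) : Ext_map tau d h = dgrp_map d h.
Proof.
have [/is_id_loop ->|hi] := pselect (is_id h).
  by rewrite Ext_map_id dgrp_map1.
have grpI k a b : dgrp_map d k a b -> dI d x b.
  move=> ab; rewrite -(dobj_grp1 H).
  apply: (ideal_sub (@pact_ideal (vertex_group x) A _ _ HG tt tt k)).
  by rewrite -(@pact_ran (vertex_group x) A _ _ HG tt tt k); exists a.
rewrite Ext_map_nid // /Ext_comp gloop_base (dobj_base H).
apply: pbij_eq => a b; split; first by case=> c [e [_ ->] ?] [_ <-].
(* The domain of gamma_h is the range of gamma_{h^{-1}}, so it also lies in I_x and the outer
   identities cut nothing off. *)
move=> ab; have ax : dI d x a by apply: (grpI (ginv h) b); rewrite dgrp_inv.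
by exists b; [exists a | split; first exact: grpI ab].
Qed.

Lemma Res_ExtK : Res tau (Ext d) = d.
Proof.
apply: dobject_eq; apply: dtriple_eq => /=.
- by apply/funext => y; rewrite Ext_map_id pran_pid.
- apply/funext => y.
  (* The range of theta at tau_y^{-1} is the domain of theta at tau_y. *)
  by rewrite (Ext_mapV d) pran_pinv Ext_map_tau (riso_dom (dobj_iso H y)).
- by apply/funext => y; rewrite Ext_map_tau (riso_ran (dobj_iso H y)).
- by apply/funext => y; apply: Ext_map_tau.
- apply: pfamily_eq => -[] [] h /=; rewrite Ext_map_loop //.
  exact: (@pact_ran (vertex_group x) A _ _ HG tt tt h).
Qed.

End ResExtK.

Theorem proposition3p3 (G : groupoid) (hG : gconnected G) (x : G)
    (tau : gtransversal x) (A : rngType) (alpha : paction G A) :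
  let theta := Ext (Res tau alpha) in
  [/\ paction_le theta alpha,
      theta = alpha <->
        (forall (y z : G) (g : mor y z), ~ is_id g ->
           act_set alpha g `<=`
             act_set alpha (tau z) `&` act_set alpha (gcomp g (tau y)))
    & forall gamma : dobject tau A, Res tau (Ext gamma) = gamma].
Proof.
split; [exact: Ext_Res_le | exact: Ext_Res_eq | exact: Res_ExtK].
Qed.
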